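(* Let $\gamma>0$ and let $\tilde{\boldsymbol{x}} = \{\tilde{x}^\iota\}_{\iota \in \mathrm{nod}(0,N)}$ with $\tilde{x}^\iota \in \mathbb{X}$ chosen arbitrarily for all $\iota \in \mathrm{nod}(0,N)$. Define $$\mathcal{Q}^{\mathrm{p}}(\boldsymbol{x},\boldsymbol{u};\tilde{\boldsymbol{x}}) = \tfrac{1}{\gamma}\,\mathrm{lse}\big(\hat{P}(\boldsymbol{x};\tilde{\boldsymbol{x}}) + \gamma L(\boldsymbol{x},\boldsymbol{u})\big),$$ where the vector $\hat{P}(\boldsymbol{x};\tilde{\boldsymbol{x}}) \in \mathbb{R}^{d^N}$ has entries $\hat{P}_s(\boldsymbol{x};\tilde{\boldsymbol{x}}) = \rho(\boldsymbol{\xi}_s, \Theta\boldsymbol{x}_s; \Theta\tilde{\boldsymbol{x}}_s)$ for $s \in \mathrm{nod}(N)$, and $\rho : \Xi^N \times \mathbb{R}^{d\times N} \to \mathbb{R}$ (with parameter $\tilde{Z} \in \mathbb{R}^{d \times N}$) is defined by $$\rho(i, Z; \tilde{Z}) = \sum_{t=0}^{N-1} \Big( Z_{i_t,t} - \mathrm{lse}(\tilde{Z}_t) - \sigma(\tilde{Z}_t)^\top (Z_t - \tilde{Z}_t)\Big),$$ with $Z_t$, $\tilde{Z}_t$ the $t$-th columns of $Z$, $\tilde{Z}$ (columns indexed $0,\dots,N-1$). Then for all $\boldsymbol{x},\boldsymbol{u}$, $$\mathcal{L}^{\mathrm{p}}(\boldsymbol{x},\boldsymbol{u}) \le \mathcal{Q}^{\mathrm{p}}(\boldsymbol{x},\boldsymbol{u};\tilde{\boldsymbol{x}}).$$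 If, furthermore, $\tilde{\boldsymbol{x}} = \boldsymbol{x}$, this holds with equality.
   Context: Data: integers $d, N, n_x, n_u \ge 1$; modes $\Xi = \{1,\dots,d\}$; a nonempty closed convex set $\mathbb{X} \subset \mathbb{R}^{n_x}$; a matrix $\Theta \in \mathbb{R}^{d \times n_x}$; convex functions $\ell : \mathbb{R}^{n_x}\times\mathbb{R}^{n_u} \to \mathbb{R}$ and $\ell_N : \mathbb{R}^{n_x} \to \mathbb{R}$. Log-sum-exp: $\mathrm{lse}(z) = \ln\big(\sum_j \exp(z_j)\big)$ for a real vector $z$ of any finite dimension. Softmax: $\sigma : \mathbb{R}^d \to \mathbb{R}^d$, $\sigma_i(z) = \exp(z_i)/\sum_{j=1}^d \exp(z_j)$. Scenario tree: a fully branched rooted tree of depth $N$. $\mathrm{nod}(k)$ is the set of nodes at depth $k$; $\mathrm{nod}(a,b) = \bigcup_{k=a}^b \mathrm{nod}(k)$. The root is node $0$. Each node $\iota \in \mathrm{nod}(0,N-1)$ has exactly $d$ children, one for each mode in $\Xi$; a child $\iota_+$ of $\iota$ carries its mode $\xi^{\iota_+} \in \Xi$. Leaves $s \in \mathrm{nod}(N)$ are called scenarios (there are $d^N$ of them), and $\mathrm{anc}(s)$ denotes the nodes on the path from the root to $s$, excluding $s$. For $\iota \in \mathrm{anc}(s)$, $\iota_+$ denotes the child of $\iota$ on the path to $s$. Variables: $\boldsymbol{x} = \{x^\iota\}_{\iota \in \mathrm{nod}(0,N)}$ with $x^\iota \in \mathbb{R}^{n_x}$, and $\boldsymbol{u}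 = \{u^\iota\}_{\iota \in \mathrm{nod}(0,N-1)}$ with $u^\iota \in \mathbb{R}^{n_u}$. For a scenario $s$, $\boldsymbol{\xi}_s = \{\xi^{\iota_+}\}_{\iota\in\mathrm{anc}(s)} \in \Xi^N$ is its mode realization and $\boldsymbol{x}_s = \{x^\iota\}_{\iota \in \mathrm{anc}(s)}$, viewed as an $n_x \times N$ matrix, are the states along it; both are ordered by the depth $t = 0,\dots,N-1$ of $\iota$ (and $\tilde{\boldsymbol{x}}_s$ likewise). Scenario cost and probability: $L_s(\boldsymbol{x},\boldsymbol{u}) = \ell_N(x^s) + \sum_{\iota \in \mathrm{anc}(s)} \ell(x^\iota,u^\iota)$ and $p(s;\boldsymbol{x}) = \prod_{\iota \in \mathrm{anc}(s)} \sigma_{\xi^{\iota_+}}(\Theta x^\iota)$. $L(\boldsymbol{x},\boldsymbol{u}) \in \mathbb{R}^{d^N}$ is the vector with entries $L_s(\boldsymbol{x},\boldsymbol{u})$. Pessimistic cost: $\mathcal{L}^{\mathrm{p}}(\boldsymbol{x},\boldsymbol{u}) = \frac{1}{\gamma} \ln \big( \sum_{s \in \mathrm{nod}(N)} p(s;\boldsymbol{x}) \exp(\gamma L_s(\boldsymbol{x},\boldsymbol{u})) \big)$. *)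

(* Defs.v *)
From HB Require Import structures.
From mathcomp Require Import all_boot all_order all_algebra.
From mathcomp Require Import all_classical all_reals all_analysis.

Set Implicit Arguments.
Unset Strict Implicit.
Unset Printing Implicit Defensive.

Import Order.TTheory GRing.Theory Num.Theory.
Import numFieldNormedType.Exports.

Local Open Scope ring_scope.

(* Entries may be indexed by any finite type, so that [lse] applies both to
   columns and to vectors indexed by scenarios. *)
Definition lse (R : realType) (J : finType) (z : J -> R) : R :=
  ln (\sum_j expR (z j)).

Definition softmax (R : realType) (d : nat) (z : 'cV[R]_d) : 'cV[R]_d :=
  \col_i (expR (z i 0) / \sum_j expR (z j 0)).

Definition dotp (R : realType) (d : nat) (a b : 'cV[R]_d) : R :=
  (a^T *m b) 0 0.

(* A node of the fully branched tree of depth N is identified with the sequence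
   of modes read on the path from the root: the root is the empty sequence, the
   depth is the size, the child of [w] with mode [e] is [rcons w e], and the
   ancestors of a node are its proper prefixes. *)
Definition node (d N : nat) : Type := N.-bseq 'I_d.

(* Non-leaf nodes: nod(0, N-1). *)
Definition inner_node (d N : nat) : Type := {w : N.-bseq 'I_d | (size w < N)%N}.

(* Leaves: nod(N). *)
Definition scenario (d N : nat) : finType := N.-tuple 'I_d.

Definition leaf (d N : nat) (s : scenario d N) : node d N := bseq_of_tuple s.

Definition node_of_inner (d N : nat) (w : inner_node d N) : node d N := val w.

(* Ancestor of [s] at depth k <= N, including [s] itself for k = N. *)
Definition prefix_node (d N : nat) (s : scenario d N) (k : nat) : node d N :=
  [bseq of take k (leaf s)].

Lemma size_prefix_node (d N : nat) (s : scenario d N) (t : 'I_N) :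
  (size (prefix_node s t) < N)%N.
Proof. by rewrite /= size_takel ?ltn_ord// size_tuple ltnW. Qed.

(* anc(s) is enumerated without repetition by the depth t = 0, ..., N-1. *)
Definition anc (d N : nat) (s : scenario d N) (t : 'I_N) : inner_node d N :=
  exist _ (prefix_node s t) (size_prefix_node s t).

(* The child of [anc s t] towards [s] is [prefix_node s t.+1], whose mode is the
   entry t of [s]; hence the mode realization of [s] is [s] itself. *)
Definition xi (d N : nat) (s : scenario d N) : N.-tuple 'I_d := s.

Section ScenarioCosts.
Variables (R : realType) (d N nx nu : nat).
Variable Theta : 'M[R]_(d, nx).
Variable ell : 'cV[R]_nx * 'cV[R]_nu -> R.
Variable ellN : 'cV[R]_nx -> R.
Variable gamma : R.

Implicit Types (x xt : node d N -> 'cV[R]_nx).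
Implicit Types (u : inner_node d N -> 'cV[R]_nu).
Implicit Types (s : scenario d N).

Definition states x s : 'M[R]_(nx, N) :=
  \matrix_(i, t) x (node_of_inner (anc s t)) i 0.

Definition scenario_cost x u : {ffun scenario d N -> R} :=
  [ffun s => ellN (x (leaf s)) +
             \sum_(t < N) ell (x (node_of_inner (anc s t)), u (anc s t))].

Definition scenario_prob s x : R :=
  \prod_(t < N)
    softmax (Theta *m x (node_of_inner (anc s t))) (tnth (xi s) t) 0.

Definition pessimistic_cost x u : R :=
  gamma^-1 *
  ln (\sum_s scenario_prob s x * expR (gamma * scenario_cost x u s)).

Definition rho (i : N.-tuple 'I_d) (Z Zt : 'M[R]_(d, N)) : R :=
  \sum_(t < N) (Z (tnth i t) t - lse (fun j => Zt j t)
                - dotp (softmax (col t Zt)) (col t Z - col t Zt)).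

Definition Phat x xt : {ffun scenario d N -> R} :=
  [ffun s => rho (xi s) (Theta *m states x s) (Theta *m states xt s)].

Definition pessimistic_surrogate x u xt : R :=
  gamma^-1 * lse (Phat x xt + gamma *: scenario_cost x u).

End ScenarioCosts.

(* Main.v *)
Require Import Defs.
From HB Require Import structures.
From mathcomp Require Import all_boot all_order all_algebra.
From mathcomp Require Import all_classical all_reals all_analysis.
From mathcomp Require Import ring lra.

Import Order.TTheory GRing.Theory Num.Theory.
Import numFieldNormedType.Exports.

Local Open Scope classical_set_scope.
Local Open Scope ring_scope.

(** The log-sum-exp function is convex with gradient [softmax], hence lies above
    its tangents ([lse_tangent_le]).  Since the log-probability of mode [i] is
    [z i 0 - lse z] ([softmax_expR]), replacing [lse z] by its tangent at [zt]
    can only raise it, and changes nothing when [zt = z].  The probability of a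
    scenario is a product along its path, so summing these bounds over the depth
    bounds it by [expR] of the entry of [Phat] ([scenario_prob_le_Phat]),
    with equality for [xt = x] ([scenario_prob_Phat]).  Weighting by the positive
    factors [expR (gamma * L s)], summing over scenarios and applying the
    increasing map [gamma^-1 * ln] yields the claim. *)

Lemma sum_expR_gt0 (R : realType) (J : finType) (j : J) (z : J -> R) :
  0 < \sum_k expR (z k).
Proof.
rewrite (bigD1 j) //= ltr_pwDl ?expR_gt0 //.
by apply: sumr_ge0 => k _; exact: expR_ge0.
Qed.

Lemma expR_lse (R : realType) (J : finType) (j : J) (z : J -> R) :
  expR (lse z) = \sum_k expR (z k).
Proof. by rewrite lnK // posrE; exact: (sum_expR_gt0 _ _ j). Qed.

Lemma sum_softmax (R : realType) (d : nat) (i : 'I_d) (z : 'cV[R]_d) :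
  \sum_j softmax z j 0 = 1.
Proof.
under eq_bigr do rewrite mxE.
by rewrite -mulr_suml divff // gt_eqF // (sum_expR_gt0 _ _ i).
Qed.

Lemma softmax_ge0 (R : realType) (d : nat) (z : 'cV[R]_d) (i : 'I_d) :
  0 <= softmax z i 0.
Proof.
by rewrite mxE divr_ge0 ?expR_ge0 ?sumr_ge0 // => k _; exact: expR_ge0.
Qed.

Lemma softmax_expR (R : realType) (d : nat) (z : 'cV[R]_d) (i : 'I_d) :
  softmax z i 0 = expR (z i 0 - lse (fun j => z j 0)).
Proof. by rewrite mxE expRD expRN (expR_lse _ _ i). Qed.

Lemma dotpE (R : realType) (d : nat) (a b : 'cV[R]_d) :
  dotp a b = \sum_j a j 0 * b j 0.
Proof. by rewrite /dotp mxE; apply: eq_bigr => j _; rewrite mxE. Qed.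

(** Jensen's inequality for the exponential: the tangent to [expR] at the mean
    [m] of the [a j] gives [expR (a j) >= expR m * (1 + (a j - m))], and the
    linear terms cancel on averaging. *)
Lemma expR_mean_le (R : realType) (J : finType) (p a : J -> R) :
  (forall j, 0 <= p j) -> \sum_j p j = 1 ->
  expR (\sum_j p j * a j) <= \sum_j p j * expR (a j).
Proof.
move=> p_ge0 p_sum1; set m := \sum_j p j * a j.
have -> : expR m = \sum_j p j * (expR m * (1 + (a j - m))).
  transitivity (expR m * (\sum_j p j + (m - (\sum_j p j) * m))).
    by rewrite p_sum1 mul1r subrr addr0 mulr1.
  rewrite mulr_suml -sumrB -big_split /= mulr_sumr.
  by apply: eq_bigr => j _; ring.
apply: ler_sum => j _; apply: ler_wpM2l => //.
rewrite -{2}[a j](subrKC m) expRD.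
by apply: ler_wpM2l; [exact: expR_ge0 | exact: expR_ge1Dx].
Qed.

(** After factoring out [expR (lse zt)], the exponentials [expR (z j)] sum to
    the [softmax zt]-average of [expR (z j - zt j)], so this is the exponential
    form of Jensen's inequality. *)
Lemma lse_tangent_le (R : realType) (d : nat) (i : 'I_d) (z zt : 'cV[R]_d) :
  lse (fun j => zt j 0) + dotp (softmax zt) (z - zt) <= lse (fun j => z j 0).
Proof.
rewrite -ler_expR expRD (expR_lse _ _ i (fun j => z j 0)).
have -> : \sum_j expR (z j 0)
    = expR (lse (fun j => zt j 0))
      * \sum_j softmax zt j 0 * expR ((z - zt) j 0).
  rewrite mulr_sumr; apply: eq_bigr => j _.
  by rewrite softmax_expR -!expRD !mxE; congr expR; lra.
apply: ler_wpM2l; first exact: expR_ge0.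
rewrite dotpE; apply: expR_mean_le; first exact: softmax_ge0.
exact: (sum_softmax _ _ i).
Qed.

Lemma col_states (R : realType) (d N nx : nat) (Theta : 'M[R]_(d, nx))
    (x : node d N -> 'cV[R]_nx) (s : scenario d N) (t : 'I_N) :
  col t (Theta *m states x s) = Theta *m x (node_of_inner (anc s t)).
Proof.
by apply/colP => i; rewrite !mxE; apply: eq_bigr => j _; rewrite mxE.
Qed.

Lemma PhatE (R : realType) (d N nx : nat) (Theta : 'M[R]_(d, nx))
    (x xt : node d N -> 'cV[R]_nx) (s : scenario d N) :
  Phat Theta x xt s =
  \sum_(t < N)
    let z := Theta *m x (node_of_inner (anc s t)) in
    let zt := Theta *m xt (node_of_inner (anc s t)) in
    (z (tnth s t) 0 - lse (fun j => zt j 0) - dotp (softmax zt) (z - zt)).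
Proof.
rewrite ffunE; apply: eq_bigr => t _ /=; rewrite -!col_states.
have entryE (A : 'M[R]_(d, N)) : (fun j => col t A j 0) = (fun j => A j t).
  by apply: funext => j; rewrite mxE.
by rewrite [col t _ (tnth s t) 0]mxE entryE.
Qed.

Lemma scenario_probE (R : realType) (d N nx : nat) (Theta : 'M[R]_(d, nx))
    (x : node d N -> 'cV[R]_nx) (s : scenario d N) :
  scenario_prob Theta s x =
  expR (\sum_(t < N)
    let z := Theta *m x (node_of_inner (anc s t)) in
    (z (tnth s t) 0 - lse (fun j => z j 0))).
Proof. by rewrite expR_sum; apply: eq_bigr => t _; exact: softmax_expR. Qed.

Lemma scenario_prob_le_Phat (R : realType) (d N nx : nat)
    (Theta : 'M[R]_(d, nx)) (x xt : node d N -> 'cV[R]_nx) (s : scenario d N) :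
  scenario_prob Theta s x <= expR (Phat Theta x xt s).
Proof.
rewrite scenario_probE PhatE ler_expR; apply: ler_sum => t _ /=.
rewrite -[leRHS]addrA -opprD lerD2l lerN2.
exact: (lse_tangent_le _ _ (tnth s t)).
Qed.

Lemma scenario_prob_Phat (R : realType) (d N nx : nat)
    (Theta : 'M[R]_(d, nx)) (x : node d N -> 'cV[R]_nx) (s : scenario d N) :
  scenario_prob Theta s x = expR (Phat Theta x x s).
Proof.
rewrite scenario_probE PhatE; congr expR; apply: eq_bigr => t _ /=.
by rewrite subrr dotpE big1 ?subr0 // => j _; rewrite [X in _ * X]mxE mulr0.
Qed.

Theorem proposition2 (R : realType) (d N nx nu : nat)
    (hd : (1 <= d)%N) (hN : (1 <= N)%N) (hnx : (1 <= nx)%N) (hnu : (1 <= nu)%N)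
    (X : set 'cV[R]_nx)
    (X_nonempty : X !=set0) (X_closed : closed X)
    (X_convex : @convex_set R 'cV[R]_nx X)
    (Theta : 'M[R]_(d, nx))
    (ell : 'cV[R]_nx * 'cV[R]_nu -> R) (ellN : 'cV[R]_nx -> R)
    (ell_convex :
      @convex_function R ('cV[R]_nx * 'cV[R]_nu)%type setT ell)
    (ellN_convex : @convex_function R 'cV[R]_nx setT ellN)
    (gamma : R) (hgamma : 0 < gamma)
    (xt : node d N -> 'cV[R]_nx) (hxt : forall w : node d N, X (xt w)) :
  forall (x : node d N -> 'cV[R]_nx) (u : inner_node d N -> 'cV[R]_nu),
    pessimistic_cost Theta ell ellN gamma x u
      <= pessimistic_surrogate Theta ell ellN gamma x u xt
    /\ (xt = x ->
        pessimistic_cost Theta ell ellN gamma x u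
          = pessimistic_surrogate Theta ell ellN gamma x u xt).
Proof.
move=> x u; rewrite /pessimistic_cost /pessimistic_surrogate /lse.
set L := scenario_cost ell ellN x u.
have -> : \sum_s expR ((Phat Theta x xt + gamma *: L) s)
    = \sum_s expR (Phat Theta x xt s) * expR (gamma * L s).
  by apply: eq_bigr => s _; rewrite !ffunE expRD.
split=> [|->]; last first.
  by congr (_ * ln _); apply: eq_bigr => s _; rewrite scenario_prob_Phat.
have le_sum : \sum_s scenario_prob Theta s x * expR (gamma * L s)
    <= \sum_s expR (Phat Theta x xt s) * expR (gamma * L s).
  apply: ler_sum => s _; apply: ler_wpM2r; first exact: expR_ge0.
  exact: scenario_prob_le_Phat.
(* The logarithm is monotone only on positive arguments, so some scenario must
   exist: the constant one at mode 0. *)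
have sum_gt0 : 0 < \sum_s scenario_prob Theta s x * expR (gamma * L s).
  under eq_bigr do rewrite scenario_prob_Phat -expRD.
  exact: (sum_expR_gt0 _ _ [tuple of nseq N (Ordinal hd)]).
rewrite ler_pM2l ?invr_gt0 // ler_ln // posrE //.
exact: lt_le_trans le_sum.
Qed.
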